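(* Let $\lambda_0>0$, $0<r\le1$, $k\in\mathbb{R}$ with $k^2=1+r-2r^2$, and $T_{max}=\frac{1}{r\lambda_0}$. For $0\le t<T_{max}$ let $$M(t)=\frac{\lambda_0}{1-r\lambda_0t}\begin{pmatrix}-(1+r)&0&k\\0&r&0\\-k&0&1\end{pmatrix},\qquad u(x,t)=M(t)x,$$ and let $Y(y_0,t)$ be the Lagrangian map associated with $u$, that is, $$\partial_tY(y_0,t)=u(Y(y_0,t),t),\qquad Y(y_0,0)=y_0 ,\qquad y_0\in\mathbb{R}^3.$$ Then for all $0\le t<T_{max}$, $$Y(y_0,t)=QD(t)Q^{-1}y_0,$$ where $$D(t)=\begin{pmatrix}(1-r\lambda_0t)^2&0&0\\0&\frac1{1-r\lambda_0t}&0\\0&0&\frac1{1-r\lambda_0t}\end{pmatrix},\qquad Q=\begin{pmatrix}\frac{1+2r}{\sqrt{k^2+(1+2r)^2}}&0&\frac{k}{\sqrt{k^2+(1+2r)^2}}\\0&1&0\\\frac{k}{\sqrt{k^2+(1+2r)^2}}&0&\frac{1+2r}{\sqrt{k^2+(1+2r)^2}}\end{pmatrix}.$$ Equivalently, if $v_1,v_2,v_3$ are the column vectors of $Q$, and $\partial_ty(t)=u(y(t),t)$ with $y(0)=y_0=c_1v_1+c_2v_2+c_3v_3$, then for all $0\le t<T_{max}$, $$y(t)=c_1(1-r\lambda_0t)^2v_1+c_2\frac1{1-r\lambda_0t}v_2+c_3\frac1{1-r\lambda_0t}v_3.$$ *)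

(* Defs.v *)
From mathcomp Require Import all_boot all_order all_algebra.
From mathcomp Require Import all_classical all_reals all_analysis.
Set Implicit Arguments.
Unset Strict Implicit.
Unset Printing Implicit Defensive.
Import Order.TTheory GRing.Theory Num.Theory.
Import numFieldNormedType.Exports.
Local Open Scope classical_set_scope.
Local Open Scope ring_scope.

(* Derivative of [f] at [t] relative to the domain [A]: the usual derivative at
   interior points of [A], and the one-sided derivative at an endpoint. *)
Definition is_derive_within (R : realType) (V : normedModType R)
    (A : set R) (f : R -> V) (t : R) (l : V) : Prop :=
  (s - t)^-1 *: (f s - f t) @[s --> within A t^'] --> l.

(* Only the values of [y] on [0, T) matter. *)
Definition is_trajectory (R : realType) (u : 'cV[R]_3 -> R -> 'cV[R]_3) (T : R)
    (y0 : 'cV[R]_3) (y : R -> 'cV[R]_3) : Prop :=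
  y 0 = y0 /\
  forall t : R, 0 <= t < T -> is_derive_within `[0, T[ y t (u (y t) t).

Definition is_lagrangian_map (R : realType) (u : 'cV[R]_3 -> R -> 'cV[R]_3)
    (T : R) (Y : 'cV[R]_3 -> R -> 'cV[R]_3) : Prop :=
  forall y0 : 'cV[R]_3, is_trajectory u T y0 (Y y0).

Definition mx3 (R : realType) (rows : seq (seq R)) : 'M[R]_3 :=
  \matrix_(i < 3, j < 3) (nth [::] rows i)`_j.

Definition Tmax (R : realType) (lambda0 r : R) : R := 1 / (r * lambda0).

Definition Mmat (R : realType) (lambda0 r k t : R) : 'M[R]_3 :=
  (lambda0 / (1 - r * lambda0 * t)) *:
  mx3 [:: [:: - (1 + r); 0; k];
          [:: 0;         r; 0];
          [:: - k;       0; 1]].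

Definition velocity (R : realType) (lambda0 r k : R) (x : 'cV[R]_3) (t : R) :
    'cV[R]_3 :=
  Mmat lambda0 r k t *m x.

Definition Dmat (R : realType) (lambda0 r t : R) : 'M[R]_3 :=
  mx3 [:: [:: (1 - r * lambda0 * t) ^+ 2; 0; 0];
          [:: 0; 1 / (1 - r * lambda0 * t); 0];
          [:: 0; 0; 1 / (1 - r * lambda0 * t)]].

Definition Qmat (R : realType) (r k : R) : 'M[R]_3 :=
  let n := Num.sqrt (k ^+ 2 + (1 + 2 * r) ^+ 2) in
  mx3 [:: [:: (1 + 2 * r) / n; 0; k / n];
          [:: 0;               1; 0];
          [:: k / n;           0; (1 + 2 * r) / n]].

(* Main.v *)
Require Import Defs.
From mathcomp Require Import all_boot all_order all_algebra.
From mathcomp Require Import all_classical all_reals all_analysis.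
From mathcomp Require Import ring.
Set Implicit Arguments.
Unset Strict Implicit.
Unset Printing Implicit Defensive.
Import Order.TTheory GRing.Theory Num.Theory.
Import numFieldNormedType.Exports.
Local Open Scope classical_set_scope.
Local Open Scope ring_scope.

(** The matrix [Mmat lambda0 r k t] is a scalar function of [t] times a constant
    matrix, so its eigenvectors do not move: the constraint on [k] makes the
    columns of [Qmat r k] eigenvectors for the eigenvalues [- 2 r], [r], [r] of
    that constant matrix ([Mmat_Qmat]), and they form a basis because
    [(1 + 2 r)^2 - k^2 = 3 r (1 + 2 r)] is positive ([Qmat_unit]).  In the
    coordinates [invmx Q *m y] the flow therefore splits into three scalar
    equations [g' = a g] with [a] proportional to [lambda0 / (1 - r lambda0 t)],
    and the diagonal entries of [Dmat] solve these with initial value [1]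
    ([stretch_derive]).

    Putting these solutions back together gives a Lagrangian map
    ([diagonalizable_flow_derive]).  That there is no other one needs no general
    uniqueness theorem: a solution [g] of the scalar equation divided by the
    known nonvanishing solution [d] has derivative zero, hence is constant by
    the mean value theorem ([linear_ode_proportional]).  Since the derivative at
    time [0] is only one-sided, the mean value theorem is applied with two-sided
    derivatives inside the interval and continuity within the interval at its
    left end. *)

(** * Limits of matrices and derivatives relative to a set *)

Lemma cvg_mxP (R : realType) (m n : nat) (I : Type) (F : set_system I)
    {FF : Filter F} (f : I -> 'M[R]_(m, n)) (L : 'M[R]_(m, n)) :
  (f @ F --> L) <-> (forall i j, f x i j @[x --> F] --> L i j).
Proof.
split=> [fL i j|fL U [P LP PU]].
  exact: (@cvg_comp _ _ _ f (fun M : 'M[R]_(m, n) => M i j) F (nbhs L) _ fL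
    (@coord_continuous _ _ _ i j L)).
near=> x; apply: PU => i j; move: i j; near: x.
by apply: filter_forall => i; apply: filter_forall => j; exact: fL.
Unshelve. all: by end_near. Qed.

Lemma mulmx_continuous (R : realType) (m n p : nat) (P : 'M[R]_(m, n)) :
  continuous (fun x : 'M[R]_(n, p) => P *m x).
Proof.
move=> x; apply/(@cvg_mxP R m p _ (nbhs x) _) => i j.
rewrite (_ : (fun y : 'M[R]_(n, p) => _) =
    (fun y : 'M[R]_(n, p) => \sum_k P i k * y k j)); last first.
  by apply/funext => y; rewrite mxE.
rewrite mxE.
apply: cvg_big => [|k _]; first exact: add_continuous.
by apply: cvgM; [exact: cvg_cst|exact: coord_continuous].
Qed.

Lemma is_derive_within_mulmx (R : realType) (m n p : nat) (P : 'M[R]_(m, n))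
    (A : set R) (f : R -> 'M[R]_(n, p)) (t : R) (l : 'M[R]_(n, p)) :
  is_derive_within A f t l ->
  is_derive_within A (fun s => P *m f s) t (P *m l).
Proof.
move=> fl; rewrite /is_derive_within.
rewrite (_ : (fun s => _) = fun s => P *m ((s - t)^-1 *: (f s - f t))).
  exact: (@cvg_comp _ _ _ _ (mulmx P) _ (nbhs l) _ fl
    (@mulmx_continuous _ _ _ _ P l)).
by apply/funext => s; rewrite -scalemxAr mulmxBr.
Qed.

Lemma is_derive_within_mxP (R : realType) (m n : nat)
    (A : set R) (f : R -> 'M[R]_(m, n)) (t : R) (l : 'M[R]_(m, n)) :
  is_derive_within A f t l <->
  forall i j, is_derive_within (V := R) A (fun s => f s i j) t (l i j).
Proof.
have E i j : (fun s => ((s - t)^-1 *: (f s - f t)) i j) =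
    fun s => (s - t)^-1 *: (f s i j - f t i j).
  by apply/funext => s; rewrite !mxE.
split=> [/cvg_mxP fl i j|fl]; first by have := fl i j; rewrite E.
by apply/cvg_mxP => i j; rewrite E; exact: fl.
Qed.

(** Multiplying the difference quotient by [s - t] gives the limit over the
    punctured neighborhoods that define the derivative; the point [t] itself is
    harmless, so [f] is continuous within [A] at [t]. *)
Lemma is_derive_within_cvg (R : realType) (V : normedModType R)
    (A : set R) (f : R -> V) (t : R) (l : V) :
  is_derive_within A f t l -> f s @[s --> within A (nbhs t)] --> f t.
Proof.
move=> fl.
have ft : f s @[s --> within A t^'] --> f t.
  have : f t + (s - t) *: ((s - t)^-1 *: (f s - f t)) @[s --> within A t^']
      --> f t + 0 *: l.
    apply: cvgD; first exact: cvg_cst.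
    apply: cvgZ => //; rewrite -(subrr t).
    apply: cvgB; last exact: cvg_cst.
    exact: cvg_trans (cvg_within _) (cvg_within _).
  rewrite scale0r addr0; apply: cvg_trans; apply: near_eq_cvg.
  have nt : \forall s \near within A t^', s != t.
    by apply: cvg_within; exact: withinT.
  near=> s; rewrite scalerA divff; first by rewrite scale1r subrKC.
  by rewrite subr_eq0; near: s.
move=> U fU.
have Us : \forall s \near t, s != t -> A s -> U (f s) by exact: ft.
suff : \forall s \near t, A s -> U (f s) by [].
apply: filterS Us => s Us As; have [->|st] := eqVneq s t.
  exact: nbhs_singleton.
exact: Us.
Unshelve. all: by end_near. Qed.

(** The substitution [s = t + h] turns the difference quotient in the increment
    [h] into the form used for derivatives relative to a set. *)
Lemma is_derive_dnbhsP (R : realType) (f : R -> R) (t : R) (l : R) :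
  is_derive t 1 f l <-> (s - t)^-1 *: (f s - f t) @[s --> t^'] --> l.
Proof.
have E : h^-1 *: ((f \o shift t) (h *: 1) - f t) @[h --> 0^'] =
         (s - t)^-1 *: (f s - f t) @[s --> t^'].
  apply/seteqP; split=> U UH.
    suff : \forall s \near t, s != t -> U ((s - t)^-1 *: (f s - f t)) by [].
    rewrite (near_shift 0 t) subr0; near=> h => /= ht.
    have : h != 0 -> U (h^-1 *: ((f \o shift t) (h *: 1) - f t)) by near: h.
    rewrite /= [h%:A]mulr1 addrK; apply.
    by apply: contra_neq ht => ->; rewrite add0r.
  suff : \forall h \near 0, h != 0 ->
    U (h^-1 *: ((f \o shift t) (h *: 1) - f t)) by [].
  have : \forall s \near t, s != t -> U ((s - t)^-1 *: (f s - f t)).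
    exact: UH.
  rewrite (near_shift 0 t) subr0; apply: filterS => h /= Uh h0.
  rewrite [h%:A]mulr1; move: Uh; rewrite addrK; apply.
  by rewrite -subr_eq0 addrK.
split=> [[df <-]|]; rewrite -E //.
move=> fl; apply: DeriveDef; first by apply/cvg_ex; exists l.
exact: cvg_lim.
Unshelve. all: by end_near. Qed.

Lemma is_derive_is_derive_within (R : realType) (A : set R) (f : R -> R)
    (t l : R) :
  is_derive t 1 f l -> is_derive_within (V := R) A f t l.
Proof.
move=> /is_derive_dnbhsP fl; apply: cvg_trans fl.
by apply: cvg_app; exact: cvg_within.
Qed.

Lemma is_derive_within_interior (R : realType) (A : set R) (f : R -> R)
    (t l : R) :
  (A°)%classic t -> is_derive_within (V := R) A f t l -> is_derive t 1 f l.
Proof.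
move=> At fl; apply/is_derive_dnbhsP => U /fl UA.
have {}UA : \forall s \near t, s != t -> A s -> U ((s - t)^-1 *: (f s - f t)).
  exact: UA.
suff : \forall s \near t, s != t -> U ((s - t)^-1 *: (f s - f t)) by [].
by apply: filterS2 At UA => s As + st; apply.
Qed.

(** * Linear equations with a fixed eigenbasis *)

(** The quotient [g / d] of two solutions of the same scalar equation has
    derivative [(a g d - g a d) / d^2 = 0], hence is constant. *)
Lemma linear_ode_proportional (R : realType) (T : R) (a d g : R -> R) :
  (forall t : R, 0 <= t < T -> d t != 0) ->
  (forall t : R, 0 <= t < T -> is_derive_within (V := R) `[0, T[ d t (a t * d t)) ->
  (forall t : R, 0 <= t < T -> is_derive_within (V := R) `[0, T[ g t (a t * g t)) ->
  forall t : R, 0 <= t < T -> g t * d 0 = d t * g 0.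
Proof.
move=> d0 dd dg t /andP[t0 tT].
have t0T : 0 <= t < T by rewrite t0.
have s0T : 0 <= (0 : R) < T by rewrite lexx (le_lt_trans t0).
have st (s : R) : s \in `[0, t] -> 0 <= s < T.
  by rewrite in_itv/= => /andP[-> /le_lt_trans->].
have [s sin||c _] :=
  @MVT_segment R (fun s => g s * (d s)^-1) (fun=> 0) 0 t t0.
- have sT : 0 <= s < T by apply: st; exact: subset_itv_oo_cc.
  have sA : ((`[0, T[)°)%classic s.
    apply: (@filterS _ (nbhs s) _ `]0, T[); first exact: subset_itv_oo_co.
    apply: near_in_itvoo; move: sin; rewrite !in_itv/=.
    by move=> /andP[-> /lt_trans]; exact.
  have ds := is_derive_within_interior sA (dd _ sT).
  have gs := is_derive_within_interior sA (dg _ sT).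
  have vs := is_deriveV (d0 _ sT) ds.
  apply: is_derive_eq.
  rewrite /GRing.scale/=; field; exact: d0.
- apply/subspace_continuousP => s; rewrite /= => /st sT.
  have sub : within `[0, t] (nbhs s) `=>` within `[0, T[ (nbhs s).
    by apply: within_subset => x /= /st; rewrite in_itv.
  apply: cvgM; last apply: cvgV; rewrite ?d0//.
    exact: cvg_trans (cvg_app _ sub) (is_derive_within_cvg (dg _ sT)).
  exact: cvg_trans (cvg_app _ sub) (is_derive_within_cvg (dd _ sT)).
rewrite mul0r => /eqP; rewrite subr_eq0 => /eqP gd.
have dt0 := d0 _ t0T; have d00 := d0 _ s0T.
by rewrite -(divfK dt0 (g t)) gd; field.
Qed.

(** In the coordinates [invmx P *m y] the system decouples, and each coordinate
    is proportional to the reference solution [d i], with factor its own initial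
    value because [d i 0 = 1]. *)
Lemma diagonalizable_flow_unique (R : realType) (n : nat) (T : R)
    (M : R -> 'M[R]_n) (P : 'M[R]_n) (a d : 'I_n -> R -> R)
    (y : R -> 'cV[R]_n) :
  P \in unitmx ->
  (forall t : R, M t *m P = P *m diag_mx (\row_i a i t)) ->
  (forall i, d i 0 = 1) ->
  (forall (i : 'I_n) (t : R), 0 <= t < T -> d i t != 0) ->
  (forall (i : 'I_n) (t : R), 0 <= t < T ->
    is_derive_within (V := R) `[0, T[ (d i) t (a i t * d i t)) ->
  (forall t : R, 0 <= t < T -> is_derive_within `[0, T[ y t (M t *m y t)) ->
  forall t : R, 0 <= t < T ->
    y t = P *m diag_mx (\row_i d i t) *m invmx P *m y 0.
Proof.
move=> Pu MP d1 d0 dd dy t tT.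
pose z s := invmx P *m y s.
have dz (i : 'I_n) (s : R) : 0 <= s < T ->
    is_derive_within (V := R) `[0, T[ (fun x => z x i 0) s (a i s * z s i 0).
  move=> sT; have := is_derive_within_mulmx (P := invmx P) (dy _ sT).
  have -> : invmx P *m (M s *m y s) = diag_mx (\row_i a i s) *m z s.
    by rewrite -{1}[y s](mulKVmx Pu) (mulmxA (M s)) MP -(mulmxA P) mulKmx.
  by move=> /is_derive_within_mxP /(_ i 0); rewrite mul_diag_mx !mxE.
rewrite -!mulmxA -[LHS](mulKVmx Pu) -/(z t) -/(z 0); congr (P *m _).
apply/matrixP => i j; rewrite ord1 mul_diag_mx [RHS]mxE [X in X * _]mxE.
have /= := linear_ode_proportional (d0 i) (dd i) (dz i) tT.
by rewrite d1 mulr1.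
Qed.

Lemma diagonalizable_flow_derive (R : realType) (n : nat) (A : set R)
    (M P : 'M[R]_n) (a : 'I_n -> R) (d : 'I_n -> R -> R) (t : R)
    (z : 'cV[R]_n) :
  M *m P = P *m diag_mx (\row_i a i) ->
  (forall i, is_derive_within (V := R) A (d i) t (a i * d i t)) ->
  is_derive_within A (fun s => P *m diag_mx (\row_i d i s) *m z) t
    (M *m (P *m diag_mx (\row_i d i t) *m z)).
Proof.
move=> MP dd; rewrite !mulmxA MP -!mulmxA.
rewrite (_ : (fun s => _) = (fun s => P *m (diag_mx (\row_i d i s) *m z))).
  apply: is_derive_within_mulmx; apply/is_derive_within_mxP => i j.
  rewrite !mul_diag_mx !mxE mulrA /is_derive_within.
  rewrite (_ : (fun s => _) = (fun s => (s - t)^-1 *: (d i s - d i t) * z i j)).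
    by apply: cvgMr_tmp; exact: dd.
  by apply/funext => s; rewrite !mul_diag_mx !mxE -mulrBl scalerAl.
by apply/funext => s; rewrite mulmxA.
Qed.

(** * The eigenbasis of the velocity field *)

Definition eigenrate (R : realType) (lambda0 r : R) (i : 'I_3) (t : R) : R :=
  lambda0 / (1 - r * lambda0 * t) * (if i == 0 then - (2 * r) else r).

Definition stretch (R : realType) (lambda0 r : R) (i : 'I_3) (t : R) : R :=
  if i == 0 then (1 - r * lambda0 * t) ^+ 2 else (1 - r * lambda0 * t)^-1.

Lemma Dmat_diag (R : realType) (lambda0 r t : R) :
  Dmat lambda0 r t = diag_mx (\row_i stretch lambda0 r i t).
Proof.
apply/matrixP => -[[|[|[|//]]] i3] [[|[|[|//]]] j3];
  by rewrite !mxE /stretch/= ?div1r ?mulr1n ?mulr0n.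
Qed.

Lemma lt_Tmax_gap_gt0 (R : realType) (lambda0 r t : R) : 0 < lambda0 -> 0 < r ->
  t < Tmax lambda0 r -> 0 < 1 - r * lambda0 * t.
Proof.
by move=> l0 r0; rewrite /Tmax ltr_pdivlMr ?mulr_gt0// mulrC subr_gt0.
Qed.

Lemma stretch_derive (R : realType) (lambda0 r t : R) (i : 'I_3) :
  1 - r * lambda0 * t != 0 ->
  is_derive t 1 (stretch lambda0 r i)
    (eigenrate lambda0 r i t * stretch lambda0 r i t).
Proof.
move=> t0; rewrite /stretch /eigenrate; case: (i == 0).
  apply: is_derive_eq; rewrite /GRing.scale/= !mulr1; field; exact: t0.
have D : is_derive t 1 (fun s => 1 - r * lambda0 * s) (- (r * lambda0)).
  by apply: is_derive_eq; rewrite /GRing.scale/=; ring.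
have := @is_deriveV _ (fun s => 1 - r * lambda0 * s) t _ 1 t0 D.
move=> /is_derive_eq; apply; rewrite /GRing.scale/=; field; exact: t0.
Qed.

(** Up to the factor [n^-2], the determinant of [Qmat r k] is
    [(1 + 2 r)^2 - k^2 = 3 r (1 + 2 r)]. *)
Lemma Qmat_unit (R : realType) (r k : R) : 0 < r ->
  k ^+ 2 = 1 + r - 2 * r ^+ 2 -> Qmat r k \in unitmx.
Proof.
move=> r0 k2; pose n := Num.sqrt (k ^+ 2 + (1 + 2 * r) ^+ 2).
have n0 : n != 0.
  rewrite gt_eqF// sqrtr_gt0 ltr_wpDl ?sqr_ge0// exprn_gt0// addr_gt0//.
  by rewrite mulr_gt0.
(* The inverse is the adjugate pattern scaled so that
   [((1 + 2 r)^2 - k^2) * (m / n) = 1]. *)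
pose m := n / (3 * r * (1 + 2 * r)).
have r12 : 1 + 2 * r != 0 by rewrite gt_eqF// addr_gt0// mulr_gt0.
have rn0 : r != 0 by rewrite gt_eqF.
pose Q' := mx3 [:: [:: (1 + 2 * r) * m; 0; - k * m];
                   [:: 0;               1; 0];
                   [:: - k * m;         0; (1 + 2 * r) * m]].
suff /mulmx1_unit[] : Qmat r k *m Q' = 1%:M by [].
apply/matrixP => -[[|[|[|//]]] i3] [[|[|[|//]]] j3];
  rewrite !mxE !big_ord_recl big_ord0 !mxE /= ?mulr1n ?mulr0n;
  rewrite ?(mul0r, mulr0, addr0, add0r, mulr1) // -/n /m.
- by field: k2; rewrite r12 n0 rn0.
- by field; rewrite r12 n0 rn0.
- by field; rewrite r12 n0 rn0.
- by field: k2; rewrite r12 n0 rn0.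
Qed.

(** The constraint on [k] is what makes the two columns outside the second one
    eigenvectors: it gives [- (1 + r) (1 + 2 r) + k^2 = - 2 r (1 + 2 r)] and
    [- k^2 + 1 + 2 r = r (1 + 2 r)]. *)
Lemma Mmat_Qmat (R : realType) (lambda0 r k t : R) :
  k ^+ 2 = 1 + r - 2 * r ^+ 2 ->
  Mmat lambda0 r k t *m Qmat r k =
  Qmat r k *m diag_mx (\row_i eigenrate lambda0 r i t).
Proof.
move=> k2; rewrite /Mmat /Qmat; set n := Num.sqrt _.
rewrite mul_mx_diag -scalemxAl.
apply/matrixP => -[[|[|[|//]]] i3] [[|[|[|//]]] j3];
  rewrite !mxE !big_ord_recl big_ord0 !mxE /eigenrate /=;
  move: (lambda0 / _) n^-1 => c m.
all: ring: k2.
Qed.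

Lemma col3_mulmx (R : realType) (Q : 'M[R]_3) (c1 c2 c3 : R) :
  c1 *: col (inord 0) Q + c2 *: col (inord 1) Q + c3 *: col (inord 2) Q =
  Q *m \col_i [:: c1; c2; c3]`_i.
Proof.
apply/matrixP => i j; rewrite !mxE !big_ord_recl big_ord0 !mxE /= addr0.
rewrite (_ : inord 0 = ord0); last by apply/val_inj; rewrite /= inordK.
rewrite (_ : inord 1 = lift ord0 ord0); last first.
  by apply/val_inj; rewrite /= inordK.
rewrite (_ : inord 2 = lift ord0 (lift ord0 ord0)); last first.
  by apply/val_inj; rewrite /= inordK.
by rewrite addrA !(mulrC (Q _ _)).
Qed.

(** * The Lagrangian map *)

Theorem theorem2p18 (R : realType) (lambda0 r k : R)
    (lambda0_gt0 : 0 < lambda0) (r_gt0 : 0 < r) (r_le1 : r <= 1)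
    (k_def : k ^+ 2 = 1 + r - 2 * r ^+ 2) :
  let u := velocity lambda0 r k in
  let T := Tmax lambda0 r in
  let Q := Qmat r k in
  let v1 := col (inord 0) Q in
  let v2 := col (inord 1) Q in
  let v3 := col (inord 2) Q in
  Q \in unitmx /\
  (exists Y : 'cV[R]_3 -> R -> 'cV[R]_3, is_lagrangian_map u T Y) /\
  (forall Y : 'cV[R]_3 -> R -> 'cV[R]_3, is_lagrangian_map u T Y ->
    forall (y0 : 'cV[R]_3) (t : R), 0 <= t < T ->
      Y y0 t = Q *m Dmat lambda0 r t *m invmx Q *m y0) /\
  (forall (c1 c2 c3 : R) (y0 : 'cV[R]_3) (y : R -> 'cV[R]_3),
    y0 = c1 *: v1 + c2 *: v2 + c3 *: v3 ->
    is_trajectory u T y0 y ->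
    forall t : R, 0 <= t < T ->
      y t = (c1 * (1 - r * lambda0 * t) ^+ 2) *: v1
          + (c2 * (1 / (1 - r * lambda0 * t))) *: v2
          + (c3 * (1 / (1 - r * lambda0 * t))) *: v3).
Proof.
move=> u T Q v1 v2 v3.
have Qu : Q \in unitmx by exact: Qmat_unit.
have gap t : 0 <= t < T -> 1 - r * lambda0 * t != 0.
  by move=> /andP[_ tT]; rewrite gt_eqF// lt_Tmax_gap_gt0.
have MQ t := Mmat_Qmat lambda0 t k_def.
have s0 i : stretch lambda0 r i 0 = 1.
  by rewrite /stretch mulr0 subr0 expr1n invr1 if_same.
have sd i t : 0 <= t < T -> is_derive_within (V := R) `[0, T[
    (stretch lambda0 r i) t (eigenrate lambda0 r i t * stretch lambda0 r i t).
  by move=> /gap t0; apply: is_derive_is_derive_within; exact: stretch_derive.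
have uniq y0 y : is_trajectory u T y0 y -> forall t, 0 <= t < T ->
    y t = Q *m Dmat lambda0 r t *m invmx Q *m y0.
  move=> [<- dy] t tT; rewrite Dmat_diag.
  apply: (diagonalizable_flow_unique Qu MQ s0 _ sd dy tT) => i {tT}t /gap t0.
  by rewrite /stretch; case: ifP => _; rewrite ?expf_neq0 ?invr_neq0.
split=> //; split; [|split].
- exists (fun y0 t => Q *m Dmat lambda0 r t *m (invmx Q *m y0)) => y0; split.
    rewrite Dmat_diag (_ : \row_i _ = const_mx 1); last first.
      by apply/rowP => i; rewrite !mxE s0.
    by rewrite diag_const_mx mulmx1 mulKVmx.
  move=> t tT; rewrite (_ : (fun _ => _) = (fun s =>
      Q *m diag_mx (\row_i stretch lambda0 r i s) *m (invmx Q *m y0))).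
    rewrite /u /velocity Dmat_diag.
    apply: diagonalizable_flow_derive (MQ t) _ => i; exact: sd.
  by apply/funext => s; rewrite Dmat_diag.
- by move=> Y Ylag y0; exact: uniq.
- move=> c1 c2 c3 y0 y -> /uniq ysol t /ysol ->.
  rewrite !col3_mulmx -mulmxA mulKmx// -mulmxA Dmat_diag; congr (Q *m _).
  apply/colP => i; rewrite mul_diag_mx !mxE /stretch.
  by case: i => -[|[|[|//]]] ? /=; rewrite ?div1r mulrC.
Qed.
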